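(* Let $c_1>c_2>0$, $c_3>0$, $c_+=\sqrt{(c_1^2+c_2^2)/2}$, and let $c_2<v<c_+$ (the intersonic range) and $Q_*>0$. Then there is no admissible steady-state splitting solution of the continuous two-string model: if $u,w$ are continuous on $[0,\infty)$, continuously differentiable up to $\eta=0$, and satisfy $$(c_1^2-v^2)u''(\eta)-c_3^2\big(u(\eta)-w(\eta)\big)=0,\qquad (c_2^2-v^2)w''(\eta)+c_3^2\big(u(\eta)-w(\eta)\big)=0\qquad(\eta>0),$$ and $Q(\eta)=w(\eta)-u(\eta)$ satisfies $Q(0)=Q_*$, then $Q$ is periodic on $[0,\infty)$ and hence the value $Q_*$ is attained again at points $\eta>0$; in particular the admissibility condition $Q(\eta)<Q_*$ for all $\eta>0$ fails.
   Context: The model: two elastic strings (wave speeds $c_1,c_2$; $c_+$ is the long-wave speed of the connected strip), connected for $\eta=x-vt>0$ by distributed bonds of stiffness $c_3^2$ and separated for $\eta<0$; $v$ is the splitting speed. A bond breaks when its strain $Q$ reaches $Q_*$, which in the steady-state formulation happens at $\eta=0$. A steady-state solution is admissible if the strain reaches $Q_*$ first at $\eta=0$ and not ahead of it, i.e. $Q(\eta)<Q_*$ for $\eta>0$. *)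

(* Defs.v *)
From Stdlib Require Import Reals.
From Coquelicot Require Import Coquelicot.
Open Scope R_scope.

(** Stdlib reals with Coquelicot.  The displacements are total functions
    [R -> R]; only their values on [[0, +oo)] are ever constrained. *)

(** Long-wave speed of the connected pair of strings. *)
Definition c_plus (c1 c2 : R) : R := sqrt ((c1 ^ 2 + c2 ^ 2) / 2).

Definition half_line (eta : R) : Prop := 0 <= eta.

(** [f] is differentiable for [eta > 0] and its derivative extends to a
    function continuous on [[0, +oo)] (one-sidedly at [0]). *)
Definition C1_up_to_zero (f : R -> R) : Prop :=
  exists f' : R -> R,
    (forall eta : R, 0 < eta -> is_derive f eta (f' eta)) /\
    continuous_on half_line f'.

(** Bond strain. *)
Definition strain (u w : R -> R) (eta : R) : R := w eta - u eta.

(** Since [Derive_n] is total, the existence of the second derivatives is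
    required separately from the equations. *)
Record steady_state_splitting (c1 c2 c3 v Qs : R) (u w : R -> R) : Prop := {
  sss_cont_u : continuous_on half_line u;
  sss_cont_w : continuous_on half_line w;
  sss_C1_u : C1_up_to_zero u;
  sss_C1_w : C1_up_to_zero w;
  sss_D2_u : forall eta : R, 0 < eta -> ex_derive_n u 2 eta;
  sss_D2_w : forall eta : R, 0 < eta -> ex_derive_n w 2 eta;
  sss_eq_u : forall eta : R, 0 < eta ->
    (c1 ^ 2 - v ^ 2) * Derive_n u 2 eta - c3 ^ 2 * (u eta - w eta) = 0;
  sss_eq_w : forall eta : R, 0 < eta ->
    (c2 ^ 2 - v ^ 2) * Derive_n w 2 eta + c3 ^ 2 * (u eta - w eta) = 0;
  sss_break : strain u w 0 = Qs
}.

Definition admissible (Qs : R) (u w : R -> R) : Prop :=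
  forall eta : R, 0 < eta -> strain u w eta < Qs.

(* Main.v *)
Require Import Defs.
From Stdlib Require Import Reals Lra.
From Coquelicot Require Import Coquelicot.
Open Scope R_scope.

(** Eliminating [u] and [w] gives [Q'' = - k^2 Q] with
    [k^2 = - c3^2 (A + B) / (A B)], [A = c1^2 - v^2], [B = c2^2 - v^2].
    In the intersonic range [B < 0 < A], while [v < c_plus] means [A + B > 0],
    so [k] is real and [Q] is a harmonic oscillation of period [2 PI / k]. *)

(** The reference point [1] is an arbitrary interior point: nothing is assumed at [0], so constancy
    cannot be anchored there. *)
Lemma zero_derive_const_pos (f : R -> R) :
  (forall x, 0 < x -> is_derive f x 0) ->
  forall x, 0 < x -> f x = f 1.
Proof.
  intros Hf x Hx.
  destruct (Rtotal_order x 1) as [H | [-> | H]].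
  - apply (eq_is_derive f x 1); [|exact H].
    intros t Ht; apply Hf; lra.
  - reflexivity.
  - symmetry; apply (eq_is_derive f 1 x); [|exact H].
    intros t Ht; apply Hf; lra.
Qed.

(* The two conserved quantities are the components of the vector
   [(f, f' / k)] in the frame rotating with angle [k x]. *)
Lemma harmonic_oscillator_pos (k : R) (f g : R -> R) :
  k <> 0 ->
  (forall x, 0 < x -> is_derive f x (g x)) ->
  (forall x, 0 < x -> is_derive g x (- k ^ 2 * f x)) ->
  exists a b, forall x, 0 < x -> f x = a * cos (k * x) + b * sin (k * x).
Proof.
  intros Hk Hf Hg.
  pose (F x := f x * cos (k * x) - g x / k * sin (k * x)).
  pose (G x := f x * sin (k * x) + g x / k * cos (k * x)).
  assert (HF : forall x, 0 < x -> F x = F 1).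
  { apply zero_derive_const_pos; intros x Hx; unfold F.
    pose proof (Hf x Hx) as Dfx; pose proof (Hg x Hx) as Dgx.
    auto_derive.
    - repeat split; eexists; eassumption.
    - replace (Derive (fun y : R => f y) x) with (g x)
        by (symmetry; apply is_derive_unique, Dfx).
      replace (Derive (fun y : R => g y) x) with (- k ^ 2 * f x)
        by (symmetry; apply is_derive_unique, Dgx).
      field; exact Hk. }
  assert (HG : forall x, 0 < x -> G x = G 1).
  { apply zero_derive_const_pos; intros x Hx; unfold G.
    pose proof (Hf x Hx) as Dfx; pose proof (Hg x Hx) as Dgx.
    auto_derive.
    - repeat split; eexists; eassumption.
    - replace (Derive (fun y : R => f y) x) with (g x)
        by (symmetry; apply is_derive_unique, Dfx).
      replace (Derive (fun y : R => g y) x) with (- k ^ 2 * f x)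
        by (symmetry; apply is_derive_unique, Dgx).
      field; exact Hk. }
  (* Rotating back gives [f = F cos + G sin], with [F] and [G] frozen at their values at [1]. *)
  exists (F 1), (G 1); intros x Hx.
  rewrite <- (HF x Hx), <- (HG x Hx); unfold F, G.
  pose proof (sin2_cos2 (k * x)) as E; unfold Rsqr in E.
  transitivity (f x * (sin (k * x) * sin (k * x) + cos (k * x) * cos (k * x))).
  - rewrite E; ring.
  - ring.
Qed.

Lemma continuous_on_half_line_right (f : R -> R) :
  continuous_on half_line f -> filterlim f (at_right 0) (locally (f 0)).
Proof.
  intros Hf.
  apply (filterlim_filter_le_1 (G := at_right 0)
           (F := within half_line (locally 0)) f).
  - intros P; unfold at_right, within; apply filter_imp.
    intros x HP Hx; apply HP; unfold half_line; lra.
  - apply Hf; unfold half_line; lra.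
Qed.

(** Both sides have the same right limit at [0], and limits are unique. This carries the closed form
    of the strain to [0], where the equations are not imposed but the breaking condition is. *)
Lemma eq_at_zero_of_eq_pos (f h : R -> R) :
  filterlim f (at_right 0) (locally (f 0)) -> continuous h 0 ->
  (forall x, 0 < x -> f x = h x) -> f 0 = h 0.
Proof.
  intros Hf Hh Heq.
  apply (filterlim_locally_unique (F := at_right 0) f); [exact Hf|].
  apply (filterlim_ext_loc h).
  - exists (mkposreal 1 Rlt_0_1); intros x _ Hx; symmetry; apply Heq, Hx.
  - apply (filterlim_filter_le_1 (G := at_right 0) (F := locally 0) h);
      [apply filter_le_within|].
    exact Hh.
Qed.

Lemma is_derive_of_C1_up_to_zero (f : R -> R) :
  C1_up_to_zero f -> forall x, 0 < x -> is_derive f x (Derive f x).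
Proof.
  intros [f' [Hf' _]] x Hx.
  apply Derive_correct; exists (f' x); apply Hf', Hx.
Qed.

(** Squaring [v < c_plus] gives [2 v^2 < c1^2 + c2^2], hence the sign of the sum; since [c2 < c1],
    it also gives [v^2 < c1^2]. *)
Lemma intersonic_signs (c1 c2 v : R) :
  0 < c2 -> c2 < c1 -> c2 < v -> v < c_plus c1 c2 ->
  0 < c1 ^ 2 - v ^ 2 /\ c2 ^ 2 - v ^ 2 < 0 /\
  0 < (c1 ^ 2 - v ^ 2) + (c2 ^ 2 - v ^ 2).
Proof.
  intros h2 h12 hv hvp; unfold c_plus in hvp.
  assert (Hs : v * v < (c1 ^ 2 + c2 ^ 2) / 2).
  { rewrite <- (sqrt_sqrt ((c1 ^ 2 + c2 ^ 2) / 2)) by nra.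
    apply Rmult_le_0_lt_compat; lra. }
  repeat split; nra.
Qed.

Lemma steady_state_strain_sinusoidal (c1 c2 c3 v Qs : R) (u w : R -> R) :
  0 < c2 -> c2 < c1 -> 0 < c3 -> c2 < v -> v < c_plus c1 c2 ->
  steady_state_splitting c1 c2 c3 v Qs u w ->
  exists k a b, 0 < k /\
    forall x, 0 <= x -> strain u w x = a * cos (k * x) + b * sin (k * x).
Proof.
  intros h2 h12 h3 hv hvp [Cu Cw C1u C1w D2u D2w Eu Ew _].
  destruct (intersonic_signs c1 c2 v) as [HA [HB HAB]]; try assumption.
  set (A := c1 ^ 2 - v ^ 2) in *; set (B := c2 ^ 2 - v ^ 2) in *.
  (* [K] is the squared wave number, written with [- B] so that every factor is positive. *)
  pose (K := c3 ^ 2 * (A + B) / (A * - B)).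
  assert (HK : 0 < K).
  { apply Rdiv_lt_0_compat; apply Rmult_lt_0_compat; try lra; apply pow_lt, h3. }
  assert (Hk : 0 < sqrt K) by (apply sqrt_lt_R0, HK).
  destruct (harmonic_oscillator_pos (sqrt K) (strain u w)
              (* Taking [Derive] itself, not the witnesses in [C1_up_to_zero], makes the next
                 derivative a difference of [Derive_n] terms of order 2. *)
              (fun x => Derive w x - Derive u x)) as [a [b Hab]].
  - lra.
  - intros x Hx.
    apply (is_derive_minus (K := R_AbsRing) (V := R_NormedModule) w u);
      apply is_derive_of_C1_up_to_zero; assumption.
  - intros x Hx.
    rewrite pow2_sqrt by lra.
    pose proof (Derive_correct _ _ (D2u x Hx)) as Du.
    pose proof (Derive_correct _ _ (D2w x Hx)) as Dw.
    specialize (Eu x Hx); specialize (Ew x Hx).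
    change (Derive (fun y => Derive_n u 1 y) x) with (Derive_n u 2 x) in Du.
    change (Derive (fun y => Derive_n w 1 y) x) with (Derive_n w 2 x) in Dw.
    replace (- K * strain u w x) with (Derive_n w 2 x - Derive_n u 2 x).
    + exact (is_derive_minus (K := R_AbsRing) (V := R_NormedModule)
               _ _ _ _ _ Dw Du).
    (* Dividing by the nonzero [A] and [B] and subtracting gives
       [Q'' = c3^2 (1/A + 1/B) Q = - K Q]. *)
    + assert (Du2 : Derive_n u 2 x = c3 ^ 2 * (u x - w x) / A).
      { apply (Rmult_eq_reg_l A); [|lra].
        transitivity (c3 ^ 2 * (u x - w x)); [lra | field; lra]. }
      assert (Dw2 : Derive_n w 2 x = - (c3 ^ 2 * (u x - w x)) / B).
      { apply (Rmult_eq_reg_l B); [|lra].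
        transitivity (- (c3 ^ 2 * (u x - w x))); [lra | field; lra]. }
      rewrite Du2, Dw2; unfold K, strain; field; lra.
  - exists (sqrt K), a, b; split; [exact Hk|].
    (* At [x = 0] the formula follows by one-sided continuity of the strain. *)
    intros x [Hx | <-]; [apply Hab, Hx|].
    apply (eq_at_zero_of_eq_pos (strain u w)
             (fun x => a * cos (sqrt K * x) + b * sin (sqrt K * x))).
    + apply continuous_on_half_line_right.
      intros x Hx; unfold strain.
      apply (filterlim_comp_2 (G := locally (w x)) (H := locally (- u x))
               w (fun y => - u y) Rplus).
      * apply Cw, Hx.
      * apply (filterlim_comp _ _ _ u Ropp _ (locally (u x)));
          [apply Cu, Hx | apply (filterlim_opp (K := R_AbsRing) (V := R_NormedModule))].
      * apply (filterlim_plus (K := R_AbsRing) (V := R_NormedModule)).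
    + apply (ex_derive_continuous (K := R_AbsRing) (V := R_NormedModule)).
      auto_derive; exact I.
    + exact Hab.
Qed.

Lemma steady_state_strain_periodic (c1 c2 c3 v Qs : R) (u w : R -> R) :
  0 < c2 -> c2 < c1 -> 0 < c3 -> c2 < v -> v < c_plus c1 c2 ->
  steady_state_splitting c1 c2 c3 v Qs u w ->
  exists T, 0 < T /\
    (forall eta, 0 <= eta -> strain u w (eta + T) = strain u w eta) /\
    (forall n : nat, strain u w (INR n * T) = Qs).
Proof.
  intros h2 h12 h3 hv hvp H.
  destruct (steady_state_strain_sinusoidal c1 c2 c3 v Qs u w)
    as [k [a [b [Hk Hab]]]]; try assumption.
  pose proof PI_RGT_0 as HPI.
  assert (HT : 0 < 2 * PI / k) by (apply Rdiv_lt_0_compat; lra).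
  assert (HP : forall eta, 0 <= eta ->
            strain u w (eta + 2 * PI / k) = strain u w eta).
  { intros eta Heta.
    rewrite !Hab by lra.
    replace (k * (eta + 2 * PI / k)) with (k * eta + 2 * PI) by (field; lra).
    now rewrite cos_plus, sin_plus, cos_2PI, sin_2PI, !Rmult_0_r, !Rmult_1_r,
      Rminus_0_r, Rplus_0_r. }
  exists (2 * PI / k); split; [exact HT|]; split; [exact HP|].
  (* The value [Qs] at [0] is propagated one period at a time; periodicity holds only on the
     half-line, so each step checks [0 <= INR n * T]. *)
  induction n as [|n IH].
  - rewrite Rmult_0_l; exact (sss_break _ _ _ _ _ _ _ H).
  - rewrite S_INR, Rmult_plus_distr_r, Rmult_1_l, HP; [exact IH|].
    apply Rmult_le_pos; [apply pos_INR | lra].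
Qed.

Theorem mainTheorem3 (c1 c2 c3 v Qs : R)
  (hc2 : 0 < c2) (hc12 : c2 < c1) (hc3 : 0 < c3)
  (hv2 : c2 < v) (hvp : v < c_plus c1 c2) (hQs : 0 < Qs) :
  (forall u w : R -> R,
     steady_state_splitting c1 c2 c3 v Qs u w ->
     (exists T : R, 0 < T /\
        (forall eta : R, 0 <= eta -> strain u w (eta + T) = strain u w eta) /\
        (forall n : nat, (0 < n)%nat -> strain u w (INR n * T) = Qs)) /\
     ~ admissible Qs u w) /\
  ~ (exists u w : R -> R,
       steady_state_splitting c1 c2 c3 v Qs u w /\ admissible Qs u w).
Proof.
  assert (Hnot : forall u w, steady_state_splitting c1 c2 c3 v Qs u w ->
            ~ admissible Qs u w).
  { intros u w H Hadm.
    destruct (steady_state_strain_periodic c1 c2 c3 v Qs u w)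
      as [T [HT [_ Hn]]]; try assumption.
    (* After one full period the strain equals [Qs] at [T > 0], against the strict inequality in
       [admissible]. *)
    specialize (Hn 1%nat); rewrite Rmult_1_l in Hn.
    specialize (Hadm T HT); lra. }
  split.
  - intros u w H; split; [|now apply Hnot].
    destruct (steady_state_strain_periodic c1 c2 c3 v Qs u w)
      as [T [HT [HP Hn]]]; try assumption.
    exists T; split; [exact HT|]; split; [exact HP|].
    intros n _; apply Hn.
  - intros [u [w [H Hadm]]]; exact (Hnot u w H Hadm).
Qed.
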